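(* Let $m\ge r\ge2$ be integers and let $F$ be an $m$-vertex $r$-graph that is smooth and $(c_1,c_2)$-bounded for constants $c_1,c_2$ with $0<c_1\le\frac{1-\pi(F)}{12m}$ and $c_2>0$. Let $\delta=\min\left\{\frac{c_2}{4},\frac{1-\pi(F)}{24m},\frac{1}{100rm^2}\right\}$. Then there exists $N_0$ such that for all $n\ge N_0$ and all nonnegative integers $t<\frac{\delta\cdot\mathrm{ex}(n,F)}{2m\binom{n-1}{r-1}}$, every $n$-vertex $r$-graph $\mathcal H$ that contains no copy of $(t+2)F$ and has at least $$\binom nr-\binom{n-t}{r}+\mathrm{ex}(n-t,F)-\frac{1-\pi(F)}{30}\binom{n}{r-1}$$ edges contains at least $t$ vertices of degree at least $d(n,F)+\frac{1-\pi(F)}{7m}\binom{n-1}{r-1}$.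
   Context: An $r$-graph is a collection of $r$-subsets (edges) of a finite vertex set; the degree of a vertex is the number of edges containing it, and $\Delta(\mathcal H)$ is the maximum degree. $tF$ denotes $t$ vertex-disjoint copies of $F$. $\mathrm{ex}(n,F)$ is the maximum number of edges in an $n$-vertex $F$-free $r$-graph; $\pi(F)=\lim_{n\to\infty}\mathrm{ex}(n,F)/\binom nr$; $F$ is degenerate if $\pi(F)=0$. $\delta(n,F)=\mathrm{ex}(n,F)-\mathrm{ex}(n-1,F)$ and $d(n,F)=r\cdot\mathrm{ex}(n,F)/n$. $F$ is $(c_1,c_2)$-bounded if there is $N_0$ such that every $r$-graph $\mathcal H$ on $n\ge N_0$ vertices with $\Delta(\mathcal H)\ge d(n,F)+c_1\binom{n-1}{r-1}$ and $|\mathcal H|\ge(1-c_2)\mathrm{ex}(n,F)$ contains a copy of $F$. $F$ is smooth if either it is degenerate or there is $N_0$ such that $|\delta(n,F)-d(n-1,F)|\le\frac{1-\pi(F)}{8v(F)}\binom n{r-1}$ for all $n\ge N_0$. *)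

(* Defs.v *)
From mathcomp Require Import all_boot all_order all_algebra.
From mathcomp Require Import classical_sets reals topology normedtype sequences.

Set Implicit Arguments.
Unset Strict Implicit.
Unset Printing Implicit Defensive.

Import Order.TTheory GRing.Theory Num.Theory.
Import numFieldNormedType.Exports.

Local Open Scope ring_scope.

(* A hypergraph on the vertex type T is its edge set {set {set T}}. *)
Definition is_rgraph (r : nat) (T : finType) (H : {set {set T}}) : bool :=
  [forall e in H, #|e| == r].

Definition hdeg (T : finType) (H : {set {set T}}) (v : T) : nat :=
  #|[set e in H | v \in e]|.

Definition maxdeg (T : finType) (H : {set {set T}}) : nat :=
  (\max_(v : T) hdeg H v)%N.

(* Copies are not required to be induced. *)
Definition contains_copy (V T : finType)
    (F : {set {set V}}) (H : {set {set T}}) : bool :=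
  [exists f : {ffun V -> T}, injectiveb f && [forall e in F, f @: e \in H]].

(* tF, on the vertex type 'I_t * V *)
Definition disjoint_copies (t : nat) (V : finType) (F : {set {set V}}) :
    {set {set 'I_t * V}} :=
  [set [set (i, v) | v in e] | i : 'I_t, e : {set V} in F].

Section Turan.
Variables (r : nat) (V : finType) (F : {set {set V}}).

Definition ex_num (n : nat) : nat :=
  (\max_(H : {set {set 'I_n}} | is_rgraph r H && ~~ contains_copy F H) #|H|)%N.

Variable R : realType.

Definition turan_density : R :=
  limn (fun n : nat => (ex_num n)%:R / 'C(n, r)%:R : R).

Definition degenerate : Prop := turan_density = 0.

Definition ex_diff (n : nat) : R := (ex_num n)%:R - (ex_num n.-1)%:R.

Definition avg_deg (n : nat) : R := r%:R * (ex_num n)%:R / n%:R.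

Definition bounded_hgraph (c1 c2 : R) : Prop :=
  exists N0 : nat, forall (n : nat) (T : finType) (H : {set {set T}}),
    (N0 <= n)%N -> #|T| = n -> is_rgraph r H ->
    avg_deg n + c1 * 'C(n.-1, r.-1)%:R <= (maxdeg H)%:R ->
    (1 - c2) * (ex_num n)%:R <= #|H|%:R ->
    contains_copy F H.

Definition smooth_hgraph : Prop :=
  degenerate \/
  exists N0 : nat, forall n : nat, (N0 <= n)%N ->
    `|ex_diff n - avg_deg n.-1|
      <= (1 - turan_density) / (8%:R * #|V|%:R) * 'C(n, r.-1)%:R.

End Turan.

(* Main.v *)
(* Write pi = pi(F), z = 1 - pi, C = 'C(n - 1, r - 1). If t >= 1, the bound on t
   forces C << ex(n, F), so that deleting O(m t) vertices changes |H|, the degrees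
   and d(n, F) only by small multiples of ex(n, F) and (z / m) C respectively.

   Let L be the set of vertices of large degree and suppose l = |L| < t; put
   k = t - l. By boundedness, every H - X with |X| <= m (t + 2) that still
   contains a vertex of L contains a copy of F; hence, starting from any k + 2
   disjoint copies of F avoiding L, one could greedily add l further ones and
   obtain (t + 2)F. So H - L has no k + 2 disjoint copies. Deleting k + 1 suitable
   m-sets from H - L then leaves an F-free graph, whence
     |H| <= 'C(n, r) - 'C(n - l, r) + ex(n - l - (k + 1) m, F)
              + (k + 1) m (d(n, F) + z / (7 m) C).
   Smoothness (if F is degenerate, monotonicity of ex and d(n, F) = o(C)) gives
   ex(n - t) - ex(n - l - (k + 1) m) >= ((k + 1) m - k) (d(n, F) - 3 z / (20 m) C),
   and 'C(n - l, r) - 'C(n - t, r) is about k C, which exceeds k d(n, F) by about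
   k z C: this contradicts the lower bound on |H|. *)
Require Import Defs.
From mathcomp Require Import all_boot all_order all_algebra.
From mathcomp Require Import zify ring lra.

Import Order.TTheory GRing.Theory Num.Theory.

Set Implicit Arguments.
Unset Strict Implicit.
Unset Printing Implicit Defensive.

(** * Induced subgraphs and their transport to ordinals *)

Section Induced.
Variables (r : nat) (V : finType) (F : {set {set V}}).
Implicit Types T S : finType.

Definition induced T (H : {set {set T}}) (W : {set T}) : {set {set T}} :=
  [set e in H | e \subset W].

Definition copy_in T (H : {set {set T}}) (W : {set T}) (f : V -> T) : Prop :=
  [/\ injective f, forall v, f v \in W & forall e, e \in F -> f @: e \in H].

(** [ex_num] speaks of graphs on ['I_n], and boundedness counts all vertices of the type, whereas
    [induced] keeps the type [T]. Pulling back along an enumeration of [W] gives a graph on exactly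
    [#|W|] vertices. *)
Definition pullback S T (g : S -> T) (H : {set {set T}}) : {set {set S}} :=
  [set e : {set S} | g @: e \in H].

Lemma rgraph_card T (H : {set {set T}}) e :
  is_rgraph r H -> e \in H -> #|e| = r.
Proof. by move=> /forall_inP rH /rH /eqP. Qed.

Lemma copyP T (H : {set {set T}}) :
  reflect (exists f : V -> T, copy_in H setT f) (contains_copy F H).
Proof.
apply: (iffP existsP) => [[f /andP[/injectiveP fI /forall_inP fF]]|[f [fI _ fF]]].
  by exists f; split=> // v; rewrite inE.
exists [ffun v => f v]; apply/andP; split.
  by apply/injectiveP => u v; rewrite !ffunE => /fI.
apply/forall_inP => e /fF; congr (_ \in H); apply: eq_imset => v.
by rewrite ffunE.
Qed.

Lemma pullback_rgraph S T (g : S -> T) (H : {set {set T}}) :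
  injective g -> is_rgraph r H -> is_rgraph r (pullback g H).
Proof.
move=> gI rH; apply/forall_inP => e; rewrite inE => /(rgraph_card rH).
by rewrite card_imset // => ->.
Qed.

Lemma pullback_copy S T (g : S -> T) (H : {set {set T}}) :
  injective g -> contains_copy F (pullback g H) ->
  exists f, copy_in H (g @: setT) f.
Proof.
move=> gI /copyP[f [fI _ fF]]; exists (g \o f); split.
- exact: inj_comp.
- by move=> v /=; rewrite imset_f.
- by move=> e /fF; rewrite inE imset_comp.
Qed.

Lemma pullback_image S T (g : S -> T) (H : {set {set T}}) (P : pred {set T}) :
  [set e in H | (e \subset g @: setT) && P e] =
  [set g @: e | e : {set S} in [set e in pullback g H | P (g @: e)]].
Proof.
apply/setP => e; apply/idP/imsetP => [|[e' + ->]].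
  rewrite inE => /and3P[eH eW Pe].
  suff eE : e = g @: (g @^-1: e) by exists (g @^-1: e); rewrite // !inE -eE eH.
  apply/setP => x; apply/idP/imsetP => [xe|[y + ->]]; last by rewrite inE.
  have /imsetP[y _ xE] := subsetP eW x xe.
  by exists y => //; rewrite inE -xE.
rewrite !inE => /andP[-> ->]; rewrite andbT /=.
exact: imsetS (subsetT _).
Qed.

Lemma card_pullback S T (g : S -> T) (H : {set {set T}}) (P : pred {set T}) :
  injective g ->
  #|[set e in pullback g H | P (g @: e)]| =
  #|[set e in H | (e \subset g @: setT) && P e]|.
Proof. by move=> gI; rewrite pullback_image card_imset //; exact: imset_inj. Qed.

Lemma imset_enum_val T (W : {set T}) :
  (fun i : 'I_#|W| => enum_val i) @: setT = W.
Proof.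
apply/setP => x; apply/imsetP/idP => [[i _ ->]|xW]; first exact: enum_valP.
by exists (enum_rank_in xW x); rewrite ?enum_rankK_in.
Qed.

Lemma card_pullback_enum T (H : {set {set T}}) (W : {set T}) :
  #|pullback (fun i : 'I_#|W| => enum_val i) H| = #|induced H W|.
Proof.
have := card_pullback H xpredT (@enum_val_inj _ (mem W)).
rewrite imset_enum_val => E; transitivity #|[set e in H | (e \subset W) && true]|.
  by rewrite -E; apply: eq_card => e; rewrite !inE andbT.
by apply: eq_card => e; rewrite !inE andbT.
Qed.

Lemma induced_le_ex T (H : {set {set T}}) (W : {set T}) :
  is_rgraph r H -> ~ (exists f, copy_in H W f) ->
  (#|induced H W| <= ex_num r F #|W|)%N.
Proof.
move=> rH Ffree; set g := fun i : 'I_#|W| => enum_val i.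
have gI : injective g by exact: enum_val_inj.
rewrite -card_pullback_enum.
apply: leq_bigmax_cond; rewrite pullback_rgraph //=.
by apply/negP => /(pullback_copy gI); rewrite imset_enum_val.
Qed.

Lemma ex_num_le n b :
  (forall H : {set {set 'I_n}}, is_rgraph r H -> ~~ contains_copy F H ->
     (#|H| <= b)%N) -> (ex_num r F n <= b)%N.
Proof. by move=> Hb; apply/bigmax_leqP => H /andP[rH nF]; apply: Hb. Qed.

Lemma Ffree_induced T (H : {set {set T}}) (W : {set T}) :
  ~~ contains_copy F H -> ~ (exists f, copy_in H W f).
Proof. by move=> /copyP nF [f [fI _ fF]]; apply: nF; exists f; split. Qed.

(** Passing to [W] loses at most the [r]-sets not contained in [W]. Sums on both sides avoid
    truncated subtraction. *)
Lemma card_induced_ge T (H : {set {set T}}) (W : {set T}) :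
  is_rgraph r H ->
  (#|H| + 'C(#|W|, r) <= #|induced H W| + 'C(#|T|, r))%N.
Proof.
move=> rH; rewrite -(cards_draws W r) -(card_draws T r).
set A := [set e : {set T} | _]; set B := [set e : {set T} | _ == _].
have HB : H \subset B.
  by apply/subsetP => e /(rgraph_card rH); rewrite inE => ->.
have AB : A \subset B by apply/subsetP => e; rewrite !inE => /andP[].
have <- : H :&: A = induced H W.
  apply/setP => e; rewrite !inE; case eH: (e \in H) => //=.
  by rewrite (rgraph_card rH eH) eqxx andbT.
rewrite -cardsUI addnC leq_add2l subset_leq_card //.
by rewrite subUset HB.
Qed.

Lemma card_rsubset_at T (W : {set T}) v : (0 < r)%N -> v \in W ->
  #|[set e : {set T} | [&& e \subset W, #|e| == r & v \in e]]| =
  'C(#|W|.-1, r.-1).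
Proof.
move=> r0 vW; apply/eqP; rewrite -(eqn_add2r 'C(#|W|.-1, r)).
have W1 : #|W|.-1 = #|W :\ v| by rewrite (cardsD1 v W) vW.
have -> : ('C(#|W|.-1, r.-1) + 'C(#|W|.-1, r) = 'C(#|W|, r))%N.
  have : (0 < #|W|)%N by apply/card_gt0P; exists v.
  by case: #|W| r r0 => [|w] [|r'] // _ _ /=; rewrite binS addnC.
rewrite W1 -!cards_draws.
rewrite -(cardsID [set e : {set T} | v \in e] [set e : {set T} | (e \subset W) && (#|e| == r)]).
apply/eqP; congr (_ + _)%N; apply: eq_card => e; rewrite !inE.
  by rewrite andbA.
rewrite subsetD1 andbA; case: (v \in e) => //=; first by rewrite andbF.
by rewrite andbT.
Qed.

Lemma hdeg_induced_ge T (H : {set {set T}}) (W : {set T}) v :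
  (0 < r)%N -> is_rgraph r H -> v \in W ->
  (hdeg H v + 'C(#|W|.-1, r.-1) <= hdeg (induced H W) v + 'C(#|T|.-1, r.-1))%N.
Proof.
move=> r0 rH vW; rewrite -(card_rsubset_at r0 vW) -cardsT.
rewrite -(card_rsubset_at r0 (in_setT v)) /hdeg.
set A := [set e : {set T} | _]; set B := [set e : {set T} | [&& _ \subset setT, _ & _]].
set Hv := [set e in H | _].
have HB : Hv \subset B.
  apply/subsetP => e; rewrite !inE subsetT /= => /andP[eH ->].
  by rewrite (rgraph_card rH eH) eqxx.
have AB : A \subset B.
  by apply/subsetP => e; rewrite !inE subsetT => /and3P[_ -> ->].
have -> : [set e in induced H W | v \in e] = Hv :&: A.
  apply/setP => e; rewrite !inE; case eH: (e \in H) => //=.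
  by rewrite (rgraph_card rH eH) eqxx; case: (e \subset W); case: (v \in e).
rewrite -cardsUI addnC leq_add2l subset_leq_card //.
by rewrite subUset HB.
Qed.

Lemma card_induced_le_hdeg T (H : {set {set T}}) (W B : {set T}) :
  (#|induced H W| <= #|induced H (W :\: B)| + \sum_(v in B) hdeg H v)%N.
Proof.
apply: (@leq_trans #|induced H (W :\: B) :|: \bigcup_(v in B) [set e in H | v \in e]|).
  apply/subset_leq_card/subsetP => e; rewrite !inE => /andP[eH eW].
  rewrite eH subsetD eW /=.
  case: (boolP [disjoint e & B]) => [//|].
  rewrite -setI_eq0 => /set0Pn[v /setIP[ve vB]].
  by apply/orP; right; apply/bigcupP; exists v; rewrite ?inE ?eH.
apply: leq_trans (leq_card_setU _ _) _; rewrite leq_add2l.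
elim/big_rec2 : _ => [|v A s _ IH]; first by rewrite cards0.
by apply: leq_trans (leq_card_setU _ _) _; rewrite leq_add2l.
Qed.

Lemma maxdeg_pullback_ge T (H : {set {set T}}) (W : {set T}) v : v \in W ->
  (hdeg (induced H W) v <=
   maxdeg (pullback (fun i : 'I_#|W| => enum_val i) H))%N.
Proof.
move=> vW; set g := fun i : 'I_#|W| => enum_val i.
have gI : injective g by exact: enum_val_inj.
apply: leq_trans (leq_bigmax (enum_rank_in vW v)); rewrite /hdeg.
have := card_pullback H (fun e => v \in e) gI; rewrite imset_enum_val.
have gv : g (enum_rank_in vW v) = v by rewrite /g enum_rankK_in.
rewrite [X in _ = X](_ : _ = #|[set e in induced H W | v \in e]|); last first.
  by apply: eq_card => e; rewrite !inE andbA.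
move=> <-; apply: eq_leq; apply: eq_card => e; rewrite !inE -{1}gv.
by rewrite mem_imset.
Qed.

End Induced.

(** * Monotonicity of Turán numbers and of their densities *)

Section TuranNumber.
Variables (r : nat) (V : finType) (F : {set {set V}}).
Local Notation ex := (ex_num r F).

Lemma ex_num_le_bin n : ex n <= 'C(n, r).
Proof.
apply: ex_num_le => H rH _; rewrite -[n in 'C(n, r)]card_ord -card_draws.
by apply/subset_leq_card/subsetP => e /(rgraph_card rH); rewrite inE => ->.
Qed.

(** An isolated vertex is added to an [F]-free graph. When [F] has isolated vertices, one of them
    could land on the new vertex; [#|V| <= n] leaves an old vertex to which it can be moved. *)
Lemma ex_num_incr n : #|V| <= n -> ex n <= ex n.+1.
Proof.
move=> Vn; apply: ex_num_le => H rH /copyP nF.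
pose g : 'I_n -> 'I_n.+1 := lift ord_max.
have gI : injective g by exact: lift_inj.
pose H' : {set {set 'I_n.+1}} := [set g @: e | e : {set 'I_n} in H].
have rH' : is_rgraph r H'.
  apply/forall_inP => e' /imsetP[e eH ->].
  by rewrite card_imset // (rgraph_card rH eH).
have <- : #|H'| = #|H| by rewrite card_imset //; exact: imset_inj.
have H'T : induced H' setT = H' by apply/setP => e; rewrite inE subsetT andbT.
rewrite -H'T -[X in ex_num _ _ X]card_ord -cardsT; apply: induced_le_ex rH' _.
case=> f [fI _ fF]; apply: nF.
have edge_ne e u : e \in F -> u \in e -> f u != ord_max.
  move=> /fF/imsetP[e' _ E] ue; have : f u \in g @: e' by rewrite -E imset_f.
  by case/imsetP => j _ ->; rewrite eq_sym neq_lift.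
have fiber u : f u != ord_max -> exists j, f u = g j.
  by rewrite eq_sym => /unlift_some[j -> _]; exists j.
have lift_copy (f' : V -> 'I_n) : injective f' ->
    (forall u, f u != ord_max -> f u = g (f' u)) ->
    exists f : V -> 'I_n, copy_in F H setT f.
  move=> f'I f'E; exists f'; split=> // e eF.
  have /imsetP[e' e'H E] := fF _ eF.
  suff -> : f' @: e = e' by [].
  apply: (imset_inj gI); rewrite -E -imset_comp.
  by apply/eq_in_imset => u ue /=; rewrite -f'E // (edge_ne e).
case: (pickP (fun u => f u == ord_max)) => [u0 /eqP fu0|no]; last first.
  have fib u : exists j, f u == g j.
    by have [j ->] := fiber u (negbT (no u)); exists j.
  pose f' u := xchoose (fib u).
  have f'E u : f u = g (f' u) by apply/eqP; apply: (xchooseP (fib u)).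
  by apply: (lift_copy f') => // u v E; apply: fI; rewrite !f'E E.
(* [u0] lies in no edge, so it may be moved to any free old vertex. *)
have [j0 j0P] : exists j0, g j0 \notin f @: [set~ u0].
  apply/existsP; apply: contraTT Vn => /existsPn gf; rewrite -ltnNge.
  have : g @: setT \subset f @: [set~ u0].
    by apply/subsetP => x /imsetP[j _ ->]; have := gf j; rewrite negbK.
  move/subset_leq_card; rewrite !card_imset // cardsT card_ord cardsC1.
  have V0 : 0 < #|V| by apply/card_gt0P; exists u0.
  by rewrite -ltnS prednK.
pose f' u := odflt j0 (unlift ord_max (f u)).
apply: (lift_copy f') => [u v|u]; last first.
  by rewrite /f'; case: unliftP => [j|] -> //; rewrite eqxx.
have g_j0 w j : f w = lift ord_max j -> j <> j0.
  move=> fw jE; move: j0P; rewrite -jE -[g j]fw imset_f // !inE.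
  by apply: contra_eqT fw => /negbNE/eqP->; rewrite fu0 neq_lift.
rewrite /f'; case: unliftP => [i|] fu; case: unliftP => [j|] fv /= E; apply: fI.
- by rewrite fu fv E.
- by case: (g_j0 _ _ fu).
- by case: (g_j0 _ _ fv).
- by rewrite fu fv.
Qed.

Lemma ex_num_mono n k : #|V| <= n -> n <= k -> ex n <= ex k.
Proof.
move=> Vn; elim: k => [|k IH]; first by rewrite leqn0 => /eqP->.
rewrite leq_eqVlt => /orP[/eqP->//|nk].
exact: leq_trans (IH nk) (ex_num_incr (leq_trans Vn nk)).
Qed.

Lemma ex_num_le_sub n k : k <= n -> ex n + 'C(k, r) <= ex k + 'C(n, r).
Proof.
move=> kn; have Ckn : 'C(k, r) <= 'C(n, r) by apply: leq_bin2l.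
suff : ex n <= ex k + 'C(n, r) - 'C(k, r) by lia.
apply: ex_num_le => H rH nF.
have : 0 < #|[set B : {set 'I_n} | B \subset setT & #|B| == k]|.
  by rewrite cards_draws cardsT card_ord bin_gt0.
case/card_gt0P => W; rewrite inE => /andP[_ /eqP cW].
have := induced_le_ex rH (Ffree_induced (W := W) nF).
have := card_induced_ge W rH; rewrite cW card_ord; lia.
Qed.

(** Double counting over the graphs [H - v]: each is [F]-free, and an edge survives the deletion of
    exactly the [n.+1 - r] vertices outside it. *)
Lemma ex_num_rec n : (n.+1 - r) * ex n.+1 <= n.+1 * ex n.
Proof.
case: (posnP (n.+1 - r)) => [->//|r_lt].
rewrite mulnC -leq_divRL //; apply: ex_num_le => H rH nF; rewrite leq_divRL //.
have -> : #|H| * (n.+1 - r) = \sum_(v : 'I_n.+1) #|induced H [set~ v]|.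
  transitivity (\sum_(v : 'I_n.+1) \sum_(e in H) (v \notin e : nat)).
    rewrite exchange_big -sum_nat_const /=; apply: eq_bigr => e eH.
    have -> : n.+1 - r = #|~: e|.
      by rewrite [RHS]cardsCs setCK card_ord (rgraph_card rH eH).
    rewrite -sum1_card big_mkcond /=.
    by apply: eq_bigr => v _; rewrite inE; case: (v \in e).
  apply: eq_bigr => v _; rewrite /induced -sum1dep_card big_mkcondr /=.
  by apply: eq_bigr => e _; rewrite subsetC sub1set inE; case: (v \in e).
rewrite -[X in X * _]card_ord -sum_nat_const leq_sum // => v _.
have := induced_le_ex rH (Ffree_induced (W := [set~ v]) nF).
by rewrite cardsC1 card_ord.
Qed.

(** Combines [ex_num_rec] with [n.+1 * 'C(n, r) = (n.+1 - r) * 'C(n.+1, r)] and iterates. The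
    cross-multiplied form stays valid when a binomial vanishes. *)
Lemma ex_density_noninc k n : k <= n -> ex n * 'C(k, r) <= ex k * 'C(n, r).
Proof.
elim: n => [|n IH]; first by rewrite leqn0 => /eqP->.
rewrite leq_eqVlt => /orP[/eqP->//|]; rewrite ltnS => kn.
have := IH kn => {}IH; have [nr|rn] := ltnP n r.
  by rewrite (bin_small (leq_ltn_trans kn nr)) muln0.
have Cn : 0 < 'C(n, r) by rewrite bin_gt0.
have step : ex n.+1 * 'C(n, r) <= ex n * 'C(n.+1, r).
  rewrite -(leq_pmul2l (ltn0Sn n)) mulnCA (mul_bin_down n.+1) mulnCA mulnA.
  rewrite [n.+1 * (_ * _)]mulnA [X in X * _]mulnC.
  by rewrite leq_mul2r mulnC ex_num_rec orbT.
rewrite -(leq_pmul2r Cn) mulnAC.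
apply: leq_trans (_ : ex n * 'C(n.+1, r) * 'C(k, r) <= _).
  by rewrite leq_mul2r step orbT.
by rewrite mulnAC [X in _ <= X]mulnAC leq_mul2r IH orbT.
Qed.
End TuranNumber.

(** * Vertex-disjoint copies inside a vertex set *)

Section Packing.
Variables (V T : finType) (F : {set {set V}}) (H : {set {set T}}).

(** Each copy is removed from the set left to the later ones, so disjointness is built in and
    inductions peel off one copy at a time. *)
Fixpoint packing p (W : {set T}) : Prop :=
  if p is p'.+1 then
    exists2 f : V -> T, copy_in F H W f & packing p' (W :\: f @: setT)
  else True.

Lemma packing_sub p (W W' : {set T}) : W \subset W' -> packing p W -> packing p W'.
Proof.
elim: p W W' => // p IH W W' sW /= [f [fI fW fF] pf]; exists f.
  by split=> // v; apply: (subsetP sW).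
by apply: IH pf; exact: setSD.
Qed.

Lemma packing_add p q (W W' : {set T}) : [disjoint W & W'] ->
  packing p W -> packing q W' -> packing (p + q) (W :|: W').
Proof.
elim: p W => [|p IH] W dW /=.
  by move=> _; apply: packing_sub; exact: subsetUr.
case=> f [fI fW fF] pf pW'; exists f.
  by split=> // v; rewrite inE fW.
have dW' : [disjoint W :\: f @: setT & W'] by apply: disjointWl dW; exact: subsetDl.
apply: packing_sub (IH _ dW' pf pW').
apply/subsetP => x; rewrite !inE => /orP[/andP[-> ->]//|xW'].
rewrite xW' orbT andbT; apply/imsetP => -[v _ xE].
by have := disjointFr dW (fW v); rewrite -xE xW'.
Qed.

Lemma packing_support p (W : {set T}) : packing p W ->
  exists U : {set T}, [/\ U \subset W, #|U| = p * #|V| & packing p U].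
Proof.
elim: p W => [|p IH] W /=; first by exists set0; rewrite sub0set cards0.
case=> f [fI fW fF] /IH[U [sU cU pU]]; exists (U :|: f @: setT); split.
- rewrite subUset (subset_trans sU (subsetDl _ _)); apply/subsetP => x.
  by case/imsetP => v _ ->.
- rewrite cardsU disjoint_setI0 ?cards0 ?subn0.
    by rewrite cU card_imset // cardsT mulSn addnC.
  by move: sU; rewrite subsetD => /andP[].
exists f; first by split=> // v; rewrite inE imset_f ?orbT.
apply: packing_sub pU; apply/subsetP => x xU; rewrite !inE xU andbT.
by have /subsetP/(_ x xU) := sU; rewrite inE => /andP[].
Qed.

Lemma packing_copies p : packing p setT -> contains_copy (disjoint_copies p F) H.
Proof.
move=> pk; suff [f fI fF] : exists2 f : 'I_p * V -> T, injective f &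
    (forall i e, e \in F -> [set f (i, v) | v in e] \in H) /\
    forall x, f x \in [set: T].
  apply/copyP; exists f; split=> [//|x|e']; first by rewrite inE.
  case/imset2P => i e _ eF ->; rewrite -imset_comp; exact: (fF.1).
elim: p setT pk => [|p IH] W /=.
  have f0 (x : 'I_0 * V) : T by case: x => -[].
  by move=> _; exists f0 => [[[]]|] //; split=> [[]|[[]]].
case=> f0 [fI0 fW0 fF0] /IH[f fI [fF fW]].
have f0W x v : f x != f0 v.
  by apply: contraTneq (fW x) => ->; rewrite !inE imset_f.
pose f' (x : 'I_p.+1 * V) := if unlift ord0 x.1 is Some j then f (j, x.2) else f0 x.2.
exists f'; last split.
- move=> [i u] [j v]; rewrite /f' /=.
  case: (unliftP ord0 i) => [i'|] ->; case: (unliftP ord0 j) => [j'|] ->.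
  + by move=> /fI[-> ->].
  + by move=> E; have := f0W (i', u) v; rewrite E eqxx.
  + by move=> E; have := f0W (j', v) u; rewrite E eqxx.
  + by move=> /fI0 ->.
- move=> i e eF; case: (unliftP ord0 i) => [j|] ->.
    by under eq_imset do rewrite /f' /= liftK; apply: fF.
  by under eq_imset do rewrite /f' /= unlift_none; apply: fF0.
- move=> [i u]; rewrite /f'; case: unliftP => [j|] _ /=; last exact: fW0.
  by have := fW (j, u); rewrite inE => /andP[].
Qed.

End Packing.

(** * Edge bound in the absence of a packing; greedy extension of packings *)

Section Counting.
Variables (r : nat) (V T : finType) (F : {set {set V}}) (H : {set {set T}}).

(** Each induction step deletes an [#|V|]-set [B], the vertex set of a copy if there is one, at a
    cost of at most [#|V| * D] edges. What remains admits one disjoint copy fewer; at [p = 0] it is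
    [F]-free. *)
Lemma card_induced_no_packing D p (W : {set T}) :
  is_rgraph r H -> (forall v, v \in W -> hdeg H v <= D) ->
  p * #|V| <= #|W| -> ~ packing F H p.+1 W ->
  #|induced H W| <= ex_num r F (#|W| - p * #|V|) + p * #|V| * D.
Proof.
move=> rH; elim: p W => [|p IH] W degW sW npk.
  rewrite !mul0n subn0 addn0; apply: induced_le_ex rH _ => -[f fc].
  by apply: npk; exists f.
have [B [sBW cB npk']] : exists B : {set T},
    [/\ B \subset W, #|B| = #|V| & ~ packing F H p.+1 (W :\: B)].
  have [/existsP[f /andP[/injectiveP fI /andP[/forallP fW /forall_inP fF]]]|nf] :=
    boolP [exists f : {ffun V -> T}, [&& injectiveb f, [forall v, f v \in W]
      & [forall e in F, f @: e \in H]]].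
    exists (f @: setT); split; [|by rewrite card_imset // cardsT|].
      by apply/subsetP => x /imsetP[v _ ->]; apply: fW.
    by move=> pk; apply: npk; exists f.
  (* Here [W] contains no copy at all, so any [#|V|]-subset serves. *)
  have : 0 < #|[set B : {set T} | B \subset W & #|B| == #|V|]|.
    by rewrite cards_draws bin_gt0 (leq_trans _ sW) // mulSn leq_addr.
  case/card_gt0P => B; rewrite inE => /andP[sBW /eqP cB]; exists B; split=> //.
  case=> f [fI fW fF] _; case/negP: nf; apply/existsP; exists [ffun v => f v].
  apply/and3P; split.
  - by apply/injectiveP => u v; rewrite !ffunE => /fI.
  - by apply/forallP => v; rewrite ffunE; have := fW v; rewrite inE => /andP[].
  - apply/forall_inP => e /fF; congr (_ \in H).
    by apply: eq_imset => v; rewrite ffunE.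
have cWB : #|W :\: B| = #|W| - #|V| by rewrite cardsD (setIidPr sBW) cB.
have := IH (W :\: B); rewrite cWB => /(_ _ _ npk') IH'.
apply: leq_trans (card_induced_le_hdeg H W B) _.
have sumB : \sum_(v in B) hdeg H v <= #|V| * D.
  rewrite -cB -sum_nat_const leq_sum // => v vB.
  by apply: degW; exact: (subsetP sBW).
have := leq_add (IH' _ _) sumB => {}IH'.
apply: leq_trans (IH' _ _) _.
- by move=> v; rewrite inE => /andP[_]; exact: degW.
- by rewrite leq_subRL; [rewrite -mulSn|rewrite (leq_trans _ sW) // mulSn leq_addr].
by rewrite -subnDA -addnA -mulnDl -mulSnr.
Qed.

(* Copies are found one at a time, each avoiding those already chosen and the
   unused vertices of [S]. *)
Lemma packing_greedy x (L S U : {set T}) :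
  (forall v (X : {set T}), v \in L -> v \notin X -> #|X| <= x ->
     exists f, copy_in F H (~: X) f) ->
  0 < #|V| -> S \subset L -> [disjoint S & U] -> #|U| + #|S| * #|V| <= x ->
  packing F H #|S| (~: U).
Proof.
move=> ext V0; move sE : #|S| => s; elim: s S U sE => // s IH S U sE sSL dSU Ux.
have /card_gt0P[v vS] : 0 < #|S| by rewrite sE.
have sS : s = #|S :\ v| by have := cardsD1 v S; rewrite vS sE => -[].
have [|||f [fI fW fF]] := ext v (U :|: S :\ v).
- exact: (subsetP sSL).
- by rewrite !inE eqxx /= orbF (disjointFr dSU vS).
- rewrite (leq_trans (leq_card_setU _ _)) // (leq_trans _ Ux) // leq_add2l -sS.
  by rewrite (leq_trans (leqnSn s)) // leq_pmulr.
have fW' u : (f u \notin U) && (f u \notin S :\ v).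
  by rewrite -negb_or -in_setU -in_setC.
exists f.
  by split=> // u; have /andP[fU _] := fW' u; rewrite inE.
rewrite setDE -setCU; apply: (IH (S :\ v)) => //.
- by rewrite (subset_trans (subD1set _ _)).
- rewrite -setI_eq0; apply/eqP/setP => z; rewrite in_setI in_set0.
  apply/negP => /andP[zS]; rewrite in_setU => /orP[zU|/imsetP[u _ zE]].
    move: zS; rewrite in_setD1 => /andP[_ zS].
    by have := disjointFr dSU zS; rewrite zU.
  by have /andP[_] := fW' u; rewrite -zE zS.
(* The budget is kept: the new copy adds [#|V|] vertices to [U], and [S] has one vertex fewer. *)
rewrite (leq_trans _ Ux) // mulSn addnA leq_add2r.
by rewrite (leq_trans (leq_card_setU _ _)) // card_imset // cardsT.
Qed.

(** The [q] copies are first confined to their support [U] of [q * #|V|] vertices, so that the sets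
    to be avoided while adding [#|L|] copies stay within [x]. *)
Lemma greedy_copies x q (L : {set T}) :
  (forall v (X : {set T}), v \in L -> v \notin X -> #|X| <= x ->
     exists f, copy_in F H (~: X) f) ->
  0 < #|V| -> (q + #|L|) * #|V| <= x -> packing F H q (~: L) ->
  contains_copy (disjoint_copies (q + #|L|) F) H.
Proof.
move=> ext V0 qx /packing_support[U [sUL cU pU]]; apply: packing_copies.
have dLU : [disjoint L & U].
  by rewrite disjoint_sym -(setCK L) -subsets_disjoint.
have dU : [disjoint U & ~: U] by rewrite -subsets_disjoint.
apply: packing_sub (subsetT (U :|: ~: U)) (packing_add dU pU _).
by apply: (packing_greedy ext) => //; rewrite cU -mulnDl.
Qed.

End Counting.

(** * Binomial coefficients under deletion of vertices *)

Lemma bin_sub_ge N s x : 0 < s -> x <= N ->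
  'C(N - x, s) + x * 'C(N - x, s.-1) <= 'C(N, s).
Proof.
case: s => // s _; elim: x => [|x IH] xN; first by rewrite subn0 addn0.
apply: leq_trans (IH (ltnW xN)).
have -> : N - x = (N - x.+1).+1 by lia.
rewrite binS mulSn addnA leq_add2l /= leq_mul2l; apply/orP; right.
exact: leq_bin2l.
Qed.

(** By Pascal's rule the difference is the sum of the ['C(N - i, s.-1)] for [1 <= i <= x]; here each
    term is bounded by the largest one, in [bin_sub_ge] by the smallest. *)
Lemma bin_sub_le N s x : 0 < s -> x <= N ->
  'C(N, s) <= 'C(N - x, s) + x * 'C(N.-1, s.-1).
Proof.
case: s => // s _; elim: x => [|x IH] xN; first by rewrite subn0 addn0.
apply: leq_trans (IH (ltnW xN)) _.
have -> : N - x = (N - x.+1).+1 by lia.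
rewrite binS mulSn addnA leq_add2r leq_add2l; apply: leq_bin2l; lia.
Qed.

Lemma bin_pred_sub_le n r x : x < n ->
  n * 'C(n.-1, r.-1) <= n * 'C(n.-1 - x, r.-1) + x * r * 'C(n.-1, r.-1).
Proof.
case: n r => // n [|[|r]] /=; rewrite ?bin0; [lia|lia|move=> xn].
case: x xn => [|x] xn; first by rewrite subn0 leq_addr.
have := @bin_sub_le n _ x.+1 (ltn0Sn r) xn; have := mul_bin_diag n r => /=.
move: 'C(n, r.+1) 'C(n - x.+1, r.+1) 'C(n.-1, r) => C c D E Ec.
(* After the case analysis [n] and [r] are shifted; the resulting extra [C] on the left is absorbed
   by [x.+1 * C]. *)
have := leq_mul (leqnn n) Ec; rewrite mulnDr [n * (_ * D)]mulnCA E; nia.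
Qed.

From mathcomp Require Import classical_sets reals topology normedtype sequences.
Import numFieldNormedType.Exports.
Local Open Scope ring_scope.

(** * Convergence to the Turán density; average extremal degrees *)

Section Density.
Variables (r : nat) (V : finType) (F : {set {set V}}) (R : realType).
Local Notation ex := (ex_num r F).
Local Notation p := (turan_density r F R).
Local Notation d := (avg_deg r F R).
Local Notation C n := ('C(n.-1, r.-1)%:R : R).

(** The shift by [r] keeps the denominators positive: for [n < r] the quotient is [0] by convention,
    which would break monotonicity. *)
Lemma density_shift_noninc :
  nonincreasing_seq (fun n => (ex (n + r))%:R / 'C(n + r, r)%:R : R).
Proof.
move=> i j ij; have C0 k : 0 < 'C(k + r, r)%:R :> R by rewrite ltr0n bin_gt0 leq_addl.
rewrite ler_pdivrMr // mulrAC ler_pdivlMr // -!natrM ler_nat.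
by apply: ex_density_noninc; rewrite leq_add2r.
Qed.

Lemma turan_density_cvg :
  ((fun n => (ex n)%:R / 'C(n, r)%:R : R) @ \oo --> p)%classic.
Proof.
pose u n : R := (ex n)%:R / 'C(n, r)%:R; suff : cvgn u by [].
have : cvgn (fun n => u (n + r)%N).
  apply: nonincreasing_is_cvgn density_shift_noninc _.
  by exists 0 => _ [n _ <-]; rewrite divr_ge0.
by case/cvg_ex => l /=; rewrite (cvg_shiftn r u) => ul; apply/cvg_ex; exists l.
Qed.

Lemma turan_density_ge0 : 0 <= p.
Proof.
apply: limr_ge; first by apply: cvgP turan_density_cvg.
by apply: nearW => n; rewrite divr_ge0.
Qed.

Lemma ex_le_density eps : 0 < eps ->
  exists N, forall n, (N <= n)%N -> (ex n)%:R <= (p + eps) * 'C(n, r)%:R :> R.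
Proof.
move=> e0; have /cvgrPdist_le/(_ eps e0)[N _ HN] := turan_density_cvg.
exists (maxn N r) => n; rewrite geq_max => /andP[Nn rn].
have /= := HN n Nn; rewrite ler_norml => /andP[h _].
by rewrite -ler_pdivrMr ?ltr0n ?bin_gt0 //; lra.
Qed.

Lemma nat_bin_pred n : (0 < r)%N -> n%:R * C n = r%:R * 'C(n, r)%:R.
Proof.
case: n r => [|n] [|s] // _; first by rewrite bin0n mul0r mulr0.
by rewrite -!natrM mul_bin_diag.
Qed.

Lemma bin_pred_sub_real (e : R) n y : (y < n)%N -> y%:R * r%:R <= e * n%:R ->
  C n - 'C(n.-1 - y, r.-1)%:R <= e * C n.
Proof.
move=> yn yr; have n0 : 0 < n%:R :> R by rewrite ltr0n (leq_ltn_trans _ yn).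
have := bin_pred_sub_le r yn; rewrite -(ler_nat R) natrD !natrM => h.
rewrite -(ler_pM2l n0); have : y%:R * r%:R * C n <= e * n%:R * C n by rewrite ler_wpM2r.
lra.
Qed.

Lemma avg_degE n : (0 < n)%N -> d n * n%:R = r%:R * (ex n)%:R.
Proof. by move=> n0; rewrite /avg_deg divfK // pnatr_eq0 -lt0n. Qed.

(** Since [n * 'C(n.-1, r.-1) = r * 'C(n, r)], the ratios d(n) / ['C(n.-1, r.-1)] and ex(n) /
    ['C(n, r)] agree. *)
Lemma avg_deg_le_of_ex n c : (0 < r)%N -> (0 < n)%N ->
  (ex n)%:R <= c * 'C(n, r)%:R -> d n <= c * C n.
Proof.
move=> r0 n0 exc; have n0' : 0 < n%:R :> R by rewrite ltr0n.
rewrite -(ler_pM2r n0') avg_degE // -mulrA [_ * n%:R]mulrC nat_bin_pred //.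
by rewrite mulrCA ler_wpM2l.
Qed.

Lemma avg_deg_ge0 n : 0 <= d n.
Proof. by rewrite /avg_deg divr_ge0 ?mulr_ge0. Qed.

Lemma avg_deg_le_bin n : (0 < r)%N -> (0 < n)%N -> d n <= C n.
Proof.
move=> r0 n0; rewrite -[C n]mul1r; apply: avg_deg_le_of_ex => //.
by rewrite mul1r ler_nat ex_num_le_bin.
Qed.

Lemma avg_deg_density k n : (0 < r)%N -> (0 < k)%N -> (k <= n)%N ->
  d n * C k <= d k * C n.
Proof.
move=> r0 k0 kn; have n0 := leq_trans k0 kn.
have k0' : 0 < k%:R :> R by rewrite ltr0n.
have n0' : 0 < n%:R :> R by rewrite ltr0n.
rewrite -(ler_pM2r k0') -(ler_pM2r n0').
have -> : d n * C k * k%:R * n%:R = (d n * n%:R) * (k%:R * C k) by ring.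
have -> : d k * C n * k%:R * n%:R = (d k * k%:R) * (n%:R * C n) by ring.
rewrite !avg_degE // !nat_bin_pred // mulrACA [leRHS]mulrACA.
by rewrite ler_wpM2l ?mulr_ge0 // -!natrM ler_nat ex_density_noninc.
Qed.

Lemma ex_diff_sum a b (D : R) : (a <= b)%N ->
  (forall j, (a < j <= b)%N -> D <= ex_diff r F R j) ->
  (b - a)%:R * D <= (ex b)%:R - (ex a)%:R.
Proof.
move=> ab; elim: b ab => [|b IH].
  by rewrite leqn0 => /eqP-> _; rewrite subnn mul0r subrr.
rewrite leq_eqVlt => /orP[/eqP-> _|]; first by rewrite subnn mul0r subrr.
rewrite ltnS => ab HD; rewrite subSn // mulrSr mulrDl mul1r.
have /IH /= {}IH := ab.
have h1 : (b - a)%:R * D <= (ex b)%:R - (ex a)%:R.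
  by apply: IH => j /andP[aj jb]; apply: HD; rewrite aj leqW.
have := HD b.+1; rewrite ltnS ab leqnn => /(_ isT); rewrite /ex_diff /=; lra.
Qed.

End Density.

(** * Copies of F avoiding a small vertex set *)

Section Extension.
Variables (r : nat) (V : finType) (F : {set {set V}}) (R : realType).
Local Notation ex := (ex_num r F).
Local Notation d := (avg_deg r F R).
Local Notation C n := ('C(n.-1, r.-1)%:R : R).

(* Here [g] plays the role of [(1 - pi(F)) / m]. *)
Lemma avg_deg_sub_le (g : R) n y : (2 <= r)%N -> 0 < g -> g <= 1 / 2 ->
  (#|V| <= n - y)%N -> (y < n)%N -> y%:R * r%:R <= g / 40 * n%:R ->
  d (n - y) <= d n + g / 79 * C n.
Proof.
move=> r2 g0 g1 Vy yn yr; have r0 := ltnW r2; have n0 := leq_ltn_trans (leq0n y) yn.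
have exle : d (n - y) * (n%:R - y%:R) <= d n * n%:R.
  rewrite -natrB ?(ltnW yn) // !avg_degE ?subn_gt0 //.
  by rewrite ler_wpM2l // ler_nat ex_num_mono // leq_subr.
have r2' : 2 <= r%:R :> R by rewrite ler_nat.
have y0 : 0 <= y%:R :> R by [].
have n0' : 0 < n%:R :> R by rewrite ltr0n.
have yle : y%:R <= g / 80 * n%:R.
  by have := ler_wpM2l y0 r2'; lra.
have C0 : 0 <= C n by [].
have dC := avg_deg_le_bin F R r0 n0; have d0 := avg_deg_ge0 r F R n.
have yn' : 0 < n%:R - y%:R :> R by rewrite subr_gt0 ltr_nat.
(* Dividing by [n - y] turns 1/80 into 1/79, because (1/79)(159/160) > 1/80. *)
have yn160 : y%:R <= n%:R / 160 :> R.
  by have := ler_wpM2r (ltW n0') g1; lra.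
rewrite -(ler_pM2r yn'); apply: le_trans exle _.
have dy : d n * y%:R <= C n * (g / 80 * n%:R) by apply: ler_pM.
have gC : 0 <= g * C n by rewrite mulr_ge0 // ltW.
have gCy : g * C n * y%:R <= g * C n * (n%:R / 160) by rewrite ler_wpM2l.
have gCn : 0 <= g * C n * n%:R by rewrite mulr_ge0.
lra.
Qed.

(** Boundedness applies to [H - X]: [v] loses at most [g / 40 * C] in degree, the average degree
    rises by at most [g / 79 * C], and 1/7 - 1/40 - 1/79 > 1/12. The edge hypothesis pays [C] for
    each vertex of [X]. *)
Lemma bounded_extension (c1 c2 g : R) N0 (T : finType) (H : {set {set T}})
    (v : T) (X : {set T}) :
  (forall (n : nat) (T : finType) (H : {set {set T}}),
    (N0 <= n)%N -> #|T| = n -> is_rgraph r H ->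
    avg_deg r F R n + c1 * 'C(n.-1, r.-1)%:R <= (maxdeg H)%:R ->
    (1 - c2) * (ex_num r F n)%:R <= #|H|%:R ->
    contains_copy F H) ->
  (2 <= r)%N -> 0 < g -> g <= 1 / 2 -> 0 < c1 -> c1 <= g / 12 -> is_rgraph r H ->
  (#|V| <= #|T| - #|X|)%N -> (N0 <= #|T| - #|X|)%N ->
  #|X|%:R * r%:R <= g / 40 * #|T|%:R ->
  d #|T| + g / 7 * C #|T| <= (hdeg H v)%:R ->
  (1 - c2) * (ex #|T|)%:R + #|X|%:R * C #|T| <= #|H|%:R ->
  v \notin X ->
  exists f, copy_in F H (~: X) f.
Proof.
move=> bnd r2 g0 g1 c10 c1g rH VX NX Xr degv cH vX.
have r0 := ltnW r2; have vW : v \in ~: X by rewrite inE.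
have cX : (#|X| < #|T|)%N.
  by rewrite -cardsT; apply/proper_card/properP; split=> //; exists v.
set n := #|T| in VX NX Xr degv cH cX *; set y := #|X| in VX NX Xr cH cX *.
have cW : #|~: X| = (n - y)%N by rewrite [LHS]cardsCs finset.setCK.
set h := fun i : 'I_#|~: X| => enum_val i.
have hI : injective h by exact: enum_val_inj.
suff /(pullback_copy hI)[f] : contains_copy F (pullback h H).
  by rewrite imset_enum_val => fc; exists f.
have n0' : 0 < n%:R :> R by rewrite ltr0n (leq_ltn_trans _ cX).
have C0 : 0 <= C n by [].
apply: (bnd (n - y)%N).
- by [].
- by rewrite card_ord.
- exact: pullback_rgraph.
- have h1 := maxdeg_pullback_ge H vW; have h2 := hdeg_induced_ge r0 rH vW.
  have h3 := bin_pred_sub_real cX Xr; have h4 := avg_deg_sub_le r2 g0 g1 VX cX Xr.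
  have pE : (n - y).-1 = (n.-1 - y)%N by rewrite -!subn1 subnAC.
  rewrite cW pE -(ler_nat R) !natrD -/n in h2.
  rewrite -(ler_nat R) -/h in h1; rewrite pE.
  have cC : 'C(n.-1 - y, r.-1)%:R <= C n by rewrite ler_nat leq_bin2l // leq_subr.
  have c0 : 0 <= 'C(n.-1 - y, r.-1)%:R :> R by [].
  have h6 : c1 * 'C(n.-1 - y, r.-1)%:R <= g / 12 * C n.
    by apply: ler_pM => //; exact: ltW.
  have gC : 0 <= g * C n by rewrite mulr_ge0 // ltW.
  lra.
- rewrite card_pullback_enum.
  have h1 := bin_sub_le r0 (ltnW cX); have h2 := card_induced_ge (~: X) rH.
  rewrite -(ler_nat R) natrD natrM in h1; rewrite cW -(ler_nat R) !natrD -/n in h2.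
  have h3 : (ex (n - y))%:R <= (ex n)%:R :> R.
    by rewrite ler_nat ex_num_mono // leq_subr.
  have h4 : 0 <= (ex (n - y))%:R :> R by [].
  have h5 : 0 <= #|induced H (~: X)|%:R :> R by [].
  (* For [c2 > 1] the required number of edges is not positive. *)
  have [c2le|c2gt] := leP c2 1; last first.
    by apply: le_trans h5; apply: mulr_le0_ge0 => //; rewrite subr_le0 ltW.
  have : (1 - c2) * (ex (n - y))%:R <= (1 - c2) * (ex n)%:R.
    by rewrite ler_wpM2l // subr_ge0.
  lra.
Qed.

End Extension.

(** * Closing numerical inequalities *)

Section FinalInequality.
Variable R : realFieldType.
Implicit Types k q g z d C e b : R.

(** Used with [k = t - l], [q = (k + 1) m], [z = g m], [e1], [e2] Turán numbers and [b1], [b2]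
    binomials. The terms [q * d] cancel; as [k + 1 <= 2 k], the losses (1/7 + 3/20) [q g C] and
    [z C' / 30] are at most 41/70 and 1/15 of the gain [k z C], and the remaining [g] terms are not
    positive. *)
Lemma final_smooth k q g z d C C' c' e1 e2 b1 b2 :
  1 <= k -> 0 < C -> 0 < z -> 0 < g -> g <= z / 2 -> q * g = (k + 1) * z ->
  b2 + k * c' <= b1 -> C - c' <= g / 80 * C -> C' <= 2 * C ->
  d <= (1 - z + g / 100) * C -> (q - k) * (d - 3 / 20 * g * C) <= e1 - e2 ->
  e2 + q * (d + g / 7 * C) - b1 < e1 - z / 30 * C' - b2.
Proof.
move=> k1 C0 z0 g0 gz qg b12 cC C'C dC e12; have k0 : 0 <= k by lra.
have h1 : k * (C - c') <= k * (g / 80 * C) by rewrite ler_wpM2l.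
have h2 : k * d <= k * ((1 - z + g / 100) * C) by rewrite ler_wpM2l.
have h3 : q * g * C = (k + 1) * z * C by rewrite qg.
have h4 : z * C' <= z * (2 * C) by rewrite ler_wpM2l // ltW.
have zC : 0 < z * C by rewrite mulr_gt0.
have h5 : z * C <= k * (z * C) by rewrite ler_peMl // ltW.
have kC : 0 <= k * C by rewrite mulr_ge0 // ltW.
have h6 : k * C * g <= k * C * (z / 2) by rewrite ler_wpM2l.
have h7 : 0 <= k * C * g by rewrite mulr_ge0 // ltW.
lra.
Qed.

(** Here [z = 1], and [d] is so small that [q * d] need not cancel: [e2 <= e1] suffices. *)
Lemma final_degenerate k q g d C C' c' e1 e2 b1 b2 :
  1 <= k -> 0 < C -> 0 < g -> g <= 1 / 2 -> 0 <= q -> q * g = k + 1 ->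
  b2 + k * c' <= b1 -> C - c' <= g / 80 * C -> C' <= 2 * C ->
  d <= g / 100 * C -> e2 <= e1 ->
  e2 + q * (d + g / 7 * C) - b1 < e1 - 1 / 30 * C' - b2.
Proof.
move=> k1 C0 g0 gz q0 qg b12 cC C'C dC e12; have k0 : 0 <= k by lra.
have h1 : k * (C - c') <= k * (g / 80 * C) by rewrite ler_wpM2l.
have h2 : q * d <= q * (g / 100 * C) by rewrite ler_wpM2l.
have h3 : q * g * C = (k + 1) * C by rewrite qg.
have h5 : C <= k * C by rewrite ler_peMl // ltW.
have kC : 0 <= k * C by rewrite mulr_ge0 // ltW.
have h6 : k * C * g <= k * C * (1 / 2) by rewrite ler_wpM2l.
lra.
Qed.

End FinalInequality.

(** * Comparison of the two bounds on the number of edges *)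

Section EdgeCount.
Variables (r : nat) (V : finType) (F : {set {set V}}) (R : realType).
Local Notation ex := (ex_num r F).
Local Notation p := (turan_density r F R).
Local Notation d := (avg_deg r F R).
Local Notation C n := ('C(n.-1, r.-1)%:R : R).
Local Notation m := #|V|.

Lemma bin_le_double n : (0 < r)%N -> (2 * r <= n)%N -> 'C(n, r.-1)%:R <= 2 * C n.
Proof.
move=> r0 rn; rewrite -natrM ler_nat.
have nr0 : (0 < n - r.-1)%N by lia.
rewrite -(leq_pmul2l nr0) -mul_bin_down mulnA.
by rewrite leq_mul2r; apply/orP; right; lia.
Qed.

(** Smoothness costs [g / 8 * C], and replacing d(j - 1) by d(n) costs [g / 40 * C] since the
    density does not increase; 1/8 + 1/40 = 3/20. *)
Lemma ex_diff_ge (g : R) n x j : (2 <= r)%N -> (0 < m)%N ->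
  g * m%:R = 1 - p -> 0 <= g -> (2 * x <= n)%N -> (r <= n)%N ->
  x%:R * r%:R <= g / 40 * n%:R -> (n - x < j < n)%N ->
  `|ex_diff r F R j - d j.-1| <= (1 - p) / (8%:R * m%:R) * 'C(j, r.-1)%:R ->
  d n - 3 / 20 * g * C n <= ex_diff r F R j.
Proof.
move=> r2 m0 gm g0 xn rn xr /andP[xj jn] sm.
have r0 := ltnW r2; have n0 : (0 < n)%N by lia.
have j0 : (0 < j.-1)%N by lia.
have jn' : (j.-1 <= n)%N by lia.
have jn1 : (j <= n.-1)%N by lia.
have x_lt : (x < n)%N by lia.
(* The binomial of d(j - 1) has top [j - 2], which is why [n - x < j] is strict. *)
have xj1 : (n.-1 - x <= j.-1.-1)%N by lia.
have C0 : 0 < C n by rewrite ltr0n bin_gt0; lia.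
have m0' : m%:R != 0 :> R by rewrite pnatr_eq0 -lt0n.
have h1 : (1 - p) / (8%:R * m%:R) * 'C(j, r.-1)%:R <= g / 8 * C n.
  have -> : (1 - p) / (8%:R * m%:R) = g / 8 by rewrite -gm; field.
  apply: ler_wpM2l; first by rewrite divr_ge0.
  by rewrite ler_nat leq_bin2l.
have h2 := avg_deg_density F R r0 j0 jn'.
have h3 := bin_pred_sub_real x_lt xr.
have h4 : 'C(n.-1 - x, r.-1)%:R <= C j.-1 by rewrite ler_nat leq_bin2l.
have h5 : d n * (C n - g / 40 * C n) <= d n * C j.-1.
  by rewrite ler_wpM2l ?avg_deg_ge0 //; lra.
have h6 : d n - g / 40 * C n <= d j.-1.
  rewrite -(ler_pM2r C0); apply: le_trans (le_trans h5 h2).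
  have gC : 0 <= g / 40 * C n by rewrite mulr_ge0 ?divr_ge0 // ltW.
  have := ler_wpM2l gC (avg_deg_le_bin F R r0 n0); lra.
move: sm; rewrite ler_norml => /andP[sm _]; lra.
Qed.

(** With [l] vertices of large degree, the left side bounds the edge number from above and the right
    side from below, ['C(n, r)] being dropped from both. *)
Lemma edge_count_lt (g : R) n t l :
  (2 <= r)%N -> (2 <= m)%N -> (2 * r <= n)%N -> (2 * m <= n)%N -> (l < t)%N ->
  (2 * (m * t.+2) <= n)%N -> (m * t.+2)%:R * r%:R <= g / 40 * n%:R ->
  g * m%:R = 1 - p -> 0 < g -> g <= 1 / 2 ->
  (ex n)%:R <= (p + g / 100) * 'C(n, r)%:R ->
  (degenerate r F R \/ forall j, (n <= 2 * j)%N ->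
    `|ex_diff r F R j - d j.-1| <= (1 - p) / (8%:R * m%:R) * 'C(j, r.-1)%:R) ->
  (ex (n - l - (t - l).+1 * m))%:R
    + ((t - l).+1 * m)%:R * (d n + g / 7 * C n) - 'C(n - l, r)%:R
  < (ex (n - t))%:R - (1 - p) / 30 * 'C(n, r.-1)%:R - 'C(n - t, r)%:R.
Proof.
move=> r2 m2 rn mn lt xn xr gm g0 g1 exn sm.
move kE: (t - l)%N => k; set q := (k.+1 * m)%N.
have r0 := ltnW r2; have n0 : (0 < n)%N by lia.
have k0 : (0 < k)%N by lia.
have C0 : 0 < C n by rewrite ltr0n bin_gt0; lia.
have t_lt : (t < n)%N by nia.
have lqx : (l + q <= m * t.+2)%N by rewrite /q; nia.
have n1E : (n - t = n - l - k)%N by lia.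
have kq : (k <= q)%N by rewrite /q; nia.
have mx : (m <= m * t.+2)%N by rewrite leq_pmulr.
have n2m : (m <= n - l - q)%N by lia.
have n2t : (n - l - q <= n - t)%N by lia.
have qkE : (q - k = n - t - (n - l - q))%N by lia.
have jP j : (n - l - q < j)%N -> (j <= n - t)%N ->
    (n - m * t.+2 < j < n)%N /\ (n <= 2 * j)%N by lia.
have rn' : (r <= n)%N by lia.
have m0 : (0 < m)%N by lia.
have ctt : (n.-1 - t <= n - t)%N by lia.
have h1 : 'C(n - t, r)%:R + k%:R * 'C(n - t, r.-1)%:R <= 'C(n - l, r)%:R :> R.
  by rewrite -natrM -natrD ler_nat n1E bin_sub_ge //; lia.
have m2' : 2 <= m%:R :> R by rewrite ler_nat.
have tr : t%:R * r%:R <= g / 80 * n%:R.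
  have : t%:R * m%:R * r%:R <= (m * t.+2)%:R * r%:R :> R.
    by rewrite -!natrM ler_nat; nia.
  have trge0 : 0 <= t%:R * r%:R :> R by rewrite mulr_ge0.
  have := ler_wpM2l trge0 m2'; lra.
have h2 : C n - 'C(n - t, r.-1)%:R <= g / 80 * C n.
  apply: le_trans (bin_pred_sub_real t_lt tr); rewrite lerD2l lerN2 ler_nat.
  by rewrite leq_bin2l.
have h3 := bin_le_double r0 rn.
have h4 := avg_deg_le_of_ex r0 n0 exn.
have qg : q%:R * g = (k%:R + 1) * (1 - p).
  by rewrite -gm /q natrM -natr1; ring.
have k1 : 1 <= k%:R :> R by rewrite ler1n.
case: sm => [p0|sm].
  rewrite /degenerate in p0; rewrite p0 subr0.
  apply: (final_degenerate k1 C0 g0 g1 _ _ h1 h2 h3) => //.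
  - by rewrite qg p0 subr0 mulr1.
  - by move: h4; rewrite p0 add0r.
  - by rewrite ler_nat ex_num_mono.
have gz : g <= (1 - p) / 2 by have := ler_wpM2l (ltW g0) m2'; lra.
have z0 : 0 < 1 - p by lra.
apply: (final_smooth k1 C0 z0 g0 gz qg h1 h2 h3); first by lra.
have -> : q%:R - k%:R = (n - t - (n - l - q))%:R :> R.
  by rewrite -natrB // qkE.
apply: ex_diff_sum => // j /andP[j1 j2]; have [jx j2n] := jP j j1 j2.
exact: (@ex_diff_ge _ _ (m * t.+2)) (ltW g0) xn rn' xr jx (sm j j2n).
Qed.

End EdgeCount.

(** * Choice of thresholds and the contradiction *)

Theorem theorem3p2 (R : realType) (m r : nat) (V : finType)
    (F : {set {set V}}) (c1 c2 : R) :
  (2 <= r)%N -> (r <= m)%N ->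
  #|V| = m -> is_rgraph r F ->
  smooth_hgraph r F R ->
  bounded_hgraph r F c1 c2 ->
  0 < c1 -> c1 <= (1 - turan_density r F R) / (12%:R * m%:R) ->
  0 < c2 ->
  let delta : R :=
    Num.min (c2 / 4%:R)
      (Num.min ((1 - turan_density r F R) / (24%:R * m%:R))
               (1 / (100%:R * r%:R * m%:R ^+ 2))) in
  exists N0 : nat, forall n : nat, (N0 <= n)%N -> forall t : nat,
    (t%:R : R) < delta * (ex_num r F n)%:R / (2%:R * m%:R * 'C(n.-1, r.-1)%:R) ->
    forall (T : finType) (H : {set {set T}}),
      #|T| = n -> is_rgraph r H ->
      ~~ contains_copy (disjoint_copies t.+2 F) H ->
      'C(n, r)%:R - 'C(n - t, r)%:R + (ex_num r F (n - t))%:R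
        - (1 - turan_density r F R) / 30%:R * 'C(n, r.-1)%:R
        <= (#|H|%:R : R) ->
      (t <= #|[set v : T |
                 (avg_deg r F R n
                   + (1 - turan_density r F R) / (7%:R * m%:R)
                     * 'C(n.-1, r.-1)%:R
                 <= (hdeg H v)%:R)%R]|)%N.
Proof.
move=> r2 rm cV _ smooth [Nb bnd] c10 c1le c20 delta.
have p0 := turan_density_ge0 r F R; set p := turan_density r F R in c1le delta p0 *.
have m2 := leq_trans r2 rm; have r0 := ltnW r2.
have m2' : 2 <= m%:R :> R by rewrite ler_nat.
have r2' : 2 <= r%:R :> R by rewrite ler_nat.
have m0' : m%:R != 0 :> R by rewrite pnatr_eq0 -lt0n ltnW.
pose g := (1 - p) / m%:R.
have gm : g * m%:R = 1 - p by rewrite divfK.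
have c1g : c1 <= g / 12.
  by have -> : g / 12 = (1 - p) / (12%:R * m%:R) by rewrite /g; field.
(* Thus pi(F) < 1, because [0 < c1 <= g / 12]. *)
have g0 : 0 < g by lra.
have z0 : 0 < 1 - p by rewrite -gm mulr_gt0 //; lra.
have z1 : 1 - p <= 1 by rewrite gerBl.
have g1 : g <= 1 / 2 by have := ler_wpM2l (ltW g0) m2'; lra.
have [d0 dc2 dg] : [/\ 0 < delta, delta <= c2 / 4 & delta <= g / 24].
  have E : (1 - p) / (24%:R * m%:R) = g / 24 by rewrite /g; field.
  rewrite /delta E; split; last 2 first.
  - by rewrite ge_min lexx.
  - by rewrite !ge_min lexx orbT.
  rewrite !lt_min; apply/and3P; split; [lra|lra|].
  by rewrite divr_gt0 // !mulr_gt0 ?exprn_gt0 //; lra.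
move: delta d0 dc2 dg => delta d0 dc2 dg.
have [Np exP] := ex_le_density r F (divr_gt0 g0 (ltr0Sn R 99)).
have [Ns sm] : exists Ns, degenerate r F R \/ forall j, (Ns <= j)%N ->
    `|ex_diff r F R j - avg_deg r F R j.-1|
      <= (1 - p) / (8%:R * #|V|%:R) * 'C(j, r.-1)%:R.
  by case: smooth => [deg|[Ns sm]]; [exists 0%N; left|exists Ns; right].
(* For [n >= K] the term [2 m r] of [m (t + 2) r] is at most [delta n / 10]; the bound on [t] gives
   [t m r <= delta n / 2]. Together they stay below [3/5 delta n <= g n / 40]. *)
have [K KP] : exists K, 20 * m%:R * r%:R <= delta * K%:R.
  exists (Num.bound (20 * m%:R * r%:R / delta)).
  rewrite [leRHS]mulrC -ler_pdivrMr //; apply/ltW/archi_boundP.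
  by rewrite divr_ge0 ?mulr_ge0 // ltW.
(* At most half of the vertices are ever deleted, hence the doubled thresholds. *)
exists (Np + 2 * Nb + 2 * Ns + 4 * m + K)%N => n Nn t ht T H cT rH nF cH.
case: (posnP t) => [->//|t1].
have [n0 NnP Kn' rn] : [/\ (0 < n)%N, (Np <= n)%N, (K <= n)%N & (2 * r <= n)%N].
  by clear -Nn r2 rm; split; lia.
have mn : (2 * #|V| <= n)%N by rewrite cV; clear -Nn; lia.
have NbX x y : (2 * x <= n)%N -> (y <= x)%N -> (m <= n - y)%N /\ (Nb <= n - y)%N.
  by clear -Nn; lia.
have NsP j : (n <= 2 * j)%N -> (Ns <= j)%N by clear -Nn; lia.
have rn1 : (r.-1 <= n.-1)%N by clear -rn; lia.
have sm' : degenerate r F R \/ forall j, (n <= 2 * j)%N ->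
    `|ex_diff r F R j - avg_deg r F R j.-1|
      <= (1 - p) / (8%:R * #|V|%:R) * 'C(j, r.-1)%:R.
  by case: sm => [|sm]; [left|right => j /NsP/sm].
set E : R := (ex_num r F n)%:R in ht.
have n0' : 0 < n%:R :> R by rewrite ltr0n.
have Kn : 20 * m%:R * r%:R <= delta * n%:R.
  by apply: le_trans KP _; rewrite ler_wpM2l ?ler_nat // ltW.
set C : R := 'C(n.-1, r.-1)%:R in ht *.
have C0 : 0 < C by rewrite ltr0n bin_gt0.
have htC : t%:R * (2 * m%:R * C) < delta * E.
  by rewrite -ltr_pdivlMr // !mulr_gt0 //; lra.
have E0 : 0 <= E by [].
have rE : r%:R * E <= n%:R * C.
  by rewrite nat_bin_pred // ler_wpM2l // ler_nat ex_num_le_bin.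
have tr : t%:R * 2 * m%:R * r%:R <= delta * n%:R.
  rewrite -(ler_pM2r C0).
  have := ler_wpM2l (ltW d0) rE; have := ler_wpM2r (ler0n R r) (ltW htC); lra.
have xr : (m * t.+2)%:R * r%:R <= g / 40 * n%:R.
  have := ler_wpM2r (ltW n0') dg; rewrite natrM -[t.+2]addn2 natrD; lra.
have xn : (2 * (m * t.+2) <= n)%N.
  rewrite -(ler_nat R) natrM.
  have := ler_wpM2l (ler0n R (m * t.+2)) r2'; have := ler_wpM2r (ltW n0') g1; lra.
have C'C := bin_le_double R r0 rn.
(* By [ex_num_le_sub], [H] has at least [E - C / 15] edges. As [t >= 1], [m (t + 2) C + C / 15 <= 4
   t m C < 2 delta E <= c2 E / 2]. *)
have edges : (1 - c2) * E + (m * t.+2)%:R * C <= #|H|%:R.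
  have := ex_num_le_sub r F (leq_subr t n); rewrite -(ler_nat R) !natrD -/E => h1.
  have h2 : (1 - p) / 30 * 'C(n, r.-1)%:R <= C / 15.
    have : (1 - p) * 'C(n, r.-1)%:R <= 1 * (2 * C) by rewrite ler_pM // ltW.
    lra.
  have t1' : 1 <= t%:R :> R by rewrite ler1n.
  have mC : 0 <= m%:R * C by rewrite mulr_ge0 // ltW.
  have h3 := ler_wpM2r mC t1'; have h4 := ler_wpM2r (ltW C0) m2'.
  have h5 := ler_wpM2r E0 dc2.
  rewrite natrM -[t.+2]addn2 natrD; lra.
have thrE : (1 - p) / (7%:R * m%:R) = g / 7 by rewrite /g; field.
set L := [set v | _]; rewrite leqNgt; apply/negP => lt_Lt.
have ext v (X : {set T}) : v \in L -> v \notin X -> (#|X| <= m * t.+2)%N ->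
    exists f, copy_in F H (~: X) f.
  rewrite inE thrE => degv vX cX.
  have cX' : #|X|%:R <= (m * t.+2)%:R :> R by rewrite ler_nat.
  apply: (bounded_extension bnd r2 g0 g1 c10 c1g rH _ _ _ _ _ vX); rewrite ?cT ?cV.
  - by have [] := NbX _ _ xn cX.
  - by have [] := NbX _ _ xn cX.
  - by apply: le_trans xr; rewrite ler_wpM2r.
  - exact: degv.
  - by apply: le_trans edges; rewrite lerD2l ler_wpM2r.
have [tE qn] : ((t - #|L|).+2 + #|L| = t.+2)%N /\ ((t - #|L|).+1 * m <= n - #|L|)%N.
  by clear -lt_Lt xn m2; split; nia.
have nopack : ~ packing F H (t - #|L|).+2 (~: L).
  move=> /(greedy_copies ext); rewrite cV tE (negbTE nF) => h.
  by have := h (ltnW m2); rewrite mulnC leqnn => /(_ isT).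
have cL : #|~: L| = (n - #|L|)%N by rewrite [LHS]cardsCs finset.setCK cT.
(* The packing bound needs a natural number, so the maximal degree outside [L] replaces the real
   threshold; it is [0] if [~: L] is empty. *)
pose D := (\max_(v in ~: L) hdeg H v)%N.
have DP : D%:R <= avg_deg r F R n + g / 7 * C.
  apply: (big_ind (fun k : nat => k%:R <= avg_deg r F R n + g / 7 * C)).
  - by rewrite addr_ge0 ?avg_deg_ge0 // mulr_ge0 ?divr_ge0 // ltW.
  - by move=> a b ha hb; rewrite /maxn; case: ifP.
  - by move=> v; rewrite !inE -ltNge thrE => /ltW.
have := card_induced_no_packing rH _ _ nopack; rewrite cL cV => /(_ D) h.
have {}h := h (fun v vL => leq_bigmax_cond (F := hdeg H) _ vL) qn.
have hL := card_induced_ge (~: L) rH; rewrite cL cT in hL.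
rewrite -(ler_nat R) natrD natrM in h; rewrite -(ler_nat R) !natrD in hL.
have xr' := xr; rewrite -cV in m2 xn xr' gm.
have := edge_count_lt r2 m2 rn mn lt_Lt xn xr' gm g0 g1 (exP n NnP) sm'.
rewrite -/C -/p cV => h'.
have : (((t - #|L|).+1 * m)%:R : R) * D%:R <=
   ((t - #|L|).+1 * m)%:R * (avg_deg r F R n + g / 7 * C) by rewrite ler_wpM2l.
lra.
Qed.
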